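(* Let $\tau>0$, $\xi\in[t_0,t_0+\tau]$, $\eta\in\mathbb R^m$, and let $y(t)\equiv y(t,\xi,\eta,\phi;t_0)$ denote the solution of $$\dot y(t)=f(y(t),y(t-\tau)),\quad t\in[t_0,t_0+\tau],\qquad y(\xi)=\eta,\qquad y(t)=\phi(t),\quad t\in[t_0-\tau,t_0).$$ With $\Phi$ and $\Psi$ as defined in the context, for any $\delta\phi\in C([t_0-\tau,t_0])$ (and any perturbation $\delta\eta\in\mathbb R^m$) one has, for $t\in[\xi,t_0+\tau]$, $$y(t,\xi,\eta+\delta\eta,\phi+\delta\phi;t_0)=y(t,\xi,\eta,\phi;t_0)+\Phi(t,\xi;t_0)\,\delta\eta+\int_{\xi-\tau}^{t-\tau}\Psi(t,\zeta;t_0)\,\delta\phi(\zeta)\,d\zeta+(t-\xi)\,O\big((|\delta\eta|+\|\delta\phi\|)^2\big),$$ with $\|\delta\phi\|=\max_{\zeta\in[\xi-\tau,t-\tau]}|\delta\phi(\zeta)|$.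
   Context: $f:\mathbb R^m\times\mathbb R^m\to\mathbb R^m$, $(z,w)\mapsto f(z,w)$, and $\phi:[t_0-\tau,t_0]\to\mathbb R^m$ are assumed suitably regular (as smooth as needed); $F_1(z,w)=\frac{\partial}{\partial z}f(z,w)$, $F_2(z,w)=\frac{\partial}{\partial w}f(z,w)$; $|\cdot|$ is any vector norm. The solution is taken to be defined on all of $[t_0,t_0+\tau]$, and $y(t-\tau)=\phi(t-\tau)$ for $t\in[t_0,t_0+\tau]$. $\Phi(t,\xi;t_0)\in\mathbb R^{m\times m}$ is the solution of $\dot\Phi(t,\xi;t_0)=F_1(y(t),y(t-\tau))\Phi(t,\xi;t_0)$, $t\in[t_0,t_0+\tau]$, $\Phi(\xi,\xi;t_0)=I$ (and likewise with any other point of $[t_0,t_0+\tau]$ in place of $\xi$ as second argument, along the same solution $y$). For $\zeta\in(\xi-\tau,t_0)$ and $t\in[\zeta+\tau,t_0+\tau]$, $\Psi(t,\zeta;t_0)=\Phi(t,\zeta+\tau;t_0)F_2(y(\zeta+\tau),y(\zeta))$. The $O$ symbol refers to $|\delta\eta|+\|\delta\phi\|\to0$. *)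

(* Defs.v *)
From HB Require Import structures.
From mathcomp Require Import all_boot all_order all_algebra.
From mathcomp Require Import all_classical all_reals all_analysis.
Set Implicit Arguments.
Unset Strict Implicit.
Unset Printing Implicit Defensive.
Import Order.TTheory GRing.Theory Num.Theory.
Import numFieldNormedType.Exports.
Local Open Scope classical_set_scope.
Local Open Scope ring_scope.

Definition vector_norm (R : realType) (m : nat) (N : 'cV[R]_m -> R) : Prop :=
  [/\ forall u v, N (u + v) <= N u + N v,
      forall (a : R) v, N (a *: v) = `|a| * N v
    & forall v, N v = 0 -> v = 0].

(* For finite-dimensional V this is the usual class C^k on the whole of V:
   differentiability together with continuity of all directional derivatives
   up to order k. *)
Fixpoint class_C (R : realType) (V W : normedModType R) (k : nat)
    (f : V -> W) : Prop :=
  if k is k'.+1 then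
    (forall x, differentiable f x) /\ (forall v, class_C k' ('D_v f))
  else continuous f.

(* Derivative relative to the set A, hence one-sided at the endpoints when A is
   a closed interval. *)
Definition derivative_within (R : realType) (V : normedModType R) (A : set R)
    (g : R -> V) (t : R) (d : V) : Prop :=
  (s - t)^-1 *: (g s - g t) @[s --> within A t^'] --> d.

Definition F1 (R : realType) (m : nat) (f : 'cV[R]_m -> 'cV[R]_m -> 'cV[R]_m)
    (z w : 'cV[R]_m) : 'M[R]_m :=
  \matrix_(i, j) ('D_(delta_mx j 0) (fun z' => f z' w) z) i 0.

Definition F2 (R : realType) (m : nat) (f : 'cV[R]_m -> 'cV[R]_m -> 'cV[R]_m)
    (z w : 'cV[R]_m) : 'M[R]_m :=
  \matrix_(i, j) ('D_(delta_mx j 0) (fun w' => f z w') w) i 0.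

(* For t in [t0, t0 + tau] the delayed value y(t - tau) is phi(t - tau).  It is
   written with phi because at t = t0 + tau it denotes phi(t0), which may differ
   from the value y(t0) reached by the differential equation: y may jump at
   t0. *)
Definition dde_solution (R : realType) (m : nat)
    (f : 'cV[R]_m -> 'cV[R]_m -> 'cV[R]_m) (t0 tau xi : R) (eta : 'cV[R]_m)
    (phi y : R -> 'cV[R]_m) : Prop :=
  [/\ forall t, t0 <= t <= t0 + tau ->
        derivative_within `[t0, t0 + tau] y t (f (y t) (phi (t - tau))),
      y xi = eta
    & forall t, t0 - tau <= t < t0 -> y t = phi t].

(* Phi t s is the value at t of the matrix solution equal to I at s; as above,
   phi (t - tau) stands for y(t - tau). *)
Definition variational_solution (R : realType) (m : nat)
    (f : 'cV[R]_m -> 'cV[R]_m -> 'cV[R]_m) (t0 tau : R)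
    (phi y : R -> 'cV[R]_m) (Phi : R -> R -> 'M[R]_m) : Prop :=
  forall s, t0 <= s <= t0 + tau ->
    (forall t, t0 <= t <= t0 + tau ->
       derivative_within `[t0, t0 + tau] (Phi ^~ s) t
         (F1 f (y t) (phi (t - tau)) *m Phi t s)) /\
    Phi s s = 1%:M.

Definition Psi (R : realType) (m : nat)
    (f : 'cV[R]_m -> 'cV[R]_m -> 'cV[R]_m) (tau : R) (y : R -> 'cV[R]_m)
    (Phi : R -> R -> 'M[R]_m) (t zeta : R) : 'M[R]_m :=
  Phi t (zeta + tau) *m F2 f (y (zeta + tau)) (y zeta).

Definition vector_integral (R : realType) (m : nat) (a b : R)
    (g : R -> 'cV[R]_m) : 'cV[R]_m :=
  \col_i (\int[lebesgue_measure]_(x in `[a, b]) (g x i 0))%R.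

(* The supremum is a maximum when a <= b and g is continuous on [a, b]. *)
Definition max_norm (R : realType) (m : nat) (N : 'cV[R]_m -> R) (a b : R)
    (g : R -> 'cV[R]_m) : R :=
  sup [set N (g x) | x in `[a, b]].

(* Main.v *)
Require Import Defs.
From mathcomp Require Import all_boot all_order all_algebra.
From mathcomp Require Import all_classical all_reals all_analysis.
From mathcomp Require Import ring.
Import Order.TTheory GRing.Theory Num.Theory.
Import numFieldNormedType.Exports.
Local Open Scope classical_set_scope.
Local Open Scope ring_scope.
Set Implicit Arguments.
Unset Strict Implicit.
Unset Printing Implicit Defensive.

(** Let [u = yd - y] be the difference of the perturbed and the unperturbed
    solution, and let [A] and [B] be the matrices [F1 f] and [F2 f] along the
    unperturbed one.  Then [u' = A u + B dphi + r], where the remainder [r] is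
    bounded by a multiple of [(|u| + |dphi|)^2] because [f] is of class C^2
    ([class_C2_local_bounds]).  A Gronwall argument bounds [|u|] by a multiple
    of the size of the perturbation ([solution_perturbation_le]), so that [r]
    is quadratic in that size.

    Fix [t].  For [s <= x <= t] the fundamental solution satisfies
    [Phi t s = Phi t x *m Phi x s], by uniqueness for the linear equation
    ([fundamental_solution_cocycle]).  Hence [s |-> Phi t s *m u s] has right
    derivative [Phi t s *m (u' s - A s *m u s)], which is
    [Phi t s *m (B dphi + r)] ([rderiv_variation]).  After the integral of
    [Phi t s *m B dphi] up to [s] is subtracted, a function [q] remains whose
    right derivative is [Phi t s *m r].  Its increment from [xi] to [t] is
    exactly the error of the expansion, and the mean value inequality bounds
    that increment by [t - xi] times a bound of order two
    ([perturbation_remainder_le]).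

    Everything is phrased with right derivatives.  The cocycle identity
    compares [Phi t s] with [Phi t x] for [x > s] directly, so its right
    derivative in [s] follows from the equation at the single point [s].  A
    left derivative would need invertibility of the fundamental solution, or
    continuity of the coefficients.  One inequality, [gronwall_rderiv], then
    yields uniqueness, the mean value inequality and all the bounds.

    Estimates are made in the maximum norm of matrices; an arbitrary norm [N]
    enters only through its equivalence with that one. *)

(** * Right derivatives and the Gronwall inequality *)

(** The retraction of the line onto [a, b].  Composing with it turns a
    function continuous on a segment into one continuous everywhere. *)
Definition clamp (R : realType) (a b x : R) : R := Num.max a (Num.min b x).

Lemma clamp_itv (R : realType) (a b x : R) : a <= b -> a <= clamp a b x <= b.
Proof.
move=> ab; rewrite /clamp le_max lexx /= ge_max ab /= ge_min lexx //.
Qed.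

Lemma clamp_id (R : realType) (a b x : R) : a <= x <= b -> clamp a b x = x.
Proof. by move=> /andP[ax xb]; rewrite /clamp min_r// max_r. Qed.

Lemma clamp_continuous (R : realType) (a b : R) : continuous (clamp a b).
Proof.
move=> x; apply: (@continuous_max R R (cst a) (fun x => Num.min b x)).
  exact: cvg_cst.
by apply: (@continuous_min R R (cst b) id); [exact: cvg_cst|exact: cvg_id].
Qed.

Lemma continuous_clamp (R : realType) (T : topologicalType) (a b : R)
    (w : R -> T) :
  a <= b -> {within `[a, b], continuous w} -> continuous (w \o clamp a b).
Proof.
move=> ab /subspace_continuousP cw x.
have cx : `[a, b]%classic (clamp a b x) by rewrite /= in_itv /= clamp_itv.
move=> A /(cw _ cx); rewrite nbhs_simpl /= /within /= => HA.
have := @clamp_continuous _ a b x _ HA; rewrite nbhs_simpl /=; apply: filterS => z /=.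
by apply; rewrite in_itv /= clamp_itv.
Qed.

(** Right derivative.  It is all that the Gronwall and mean value
    inequalities below need from a continuous function. *)
Definition rderiv (R : realType) (V : normedModType R) (w : R -> V) (s : R)
    (d : V) : Prop :=
  (x - s)^-1 *: (w x - w s) @[x --> s^'+] --> d.

Lemma rderiv_norm_le (R : realType) (V : normedModType R) (w : R -> V)
    (s e : R) (d : V) :
  rderiv w s d -> 0 < e ->
  \forall x \near s^'+, `|w x| <= `|w s| + (x - s) * (`|d| + e).
Proof.
move=> /cvgr_norm_le + e0 => /(_ (`|d| + e)).
rewrite ltrDl => /(_ e0); near_simpl => H.
near=> x.
have sx : 0 < x - s by rewrite subr_gt0; near: x; exact: nbhs_right_gt.
have : `|(x - s)^-1 *: (w x - w s)| <= `|d| + e by near: x.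
rewrite normrZ gtr0_norm ?invr_gt0// ler_pdivrMl// => wx.
apply: le_trans (_ : `|w s| + `|w x - w s| <= _); last by rewrite lerD2l.
by rewrite -lerBlDl lerB_dist.
Unshelve. all: by end_near. Qed.

(** For [e > 0] the function [G e] in the proof grows strictly faster than the
    hypothesis allows [`|w|] to grow where [`|w| <= G e].  If [`|w|] exceeded it
    somewhere, then right after the last earlier point where [`|w| <= G e] it
    would still be below [G e].  Let [e] tend to 0.

    The differential inequality is only required where [`|w s| <= M], provided
    the resulting bound is below [M].  A function [w] that solves an equation
    with a locally Lipschitz right-hand side is thereby kept in the region
    where the Lipschitz constant is valid; this takes the place of a
    continuation argument. *)
Lemma gronwall_rderiv (R : realType) (V : normedModType R) (w w' : R -> V)
    (a b L beta M : R) :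
  0 <= L -> 0 <= beta -> {within `[a, b], continuous w} ->
  (`|w a| + beta * (b - a)) * expR (L * (b - a)) < M ->
  (forall s, a < s < b -> `|w s| <= M ->
     rderiv w s (w' s) /\ `|w' s| <= L * `|w s| + beta) ->
  forall t, a <= t <= b ->
    `|w t| <= (`|w a| + beta * (t - a)) * expR (L * (t - a)).
Proof.
move=> L0 beta0 cw wM wd t /andP[at_ tb].
pose G (e x : R) : R :=
  (`|w a| + e + (beta + e) * (x - a)) * expR (L * (x - a)).
have cG e : continuous (G e).
  move=> x; apply: cvgM.
    apply: cvgD; first exact: cvg_cst.
    apply: cvgM; first exact: cvg_cst.
    by apply: cvgB; [exact: cvg_id|exact: cvg_cst].
  apply: (@continuous_comp _ _ _ (fun x => L * (x - a)) expR); last exact: continuous_expR.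
  apply: cvgM; first exact: cvg_cst.
  by apply: cvgB; [exact: cvg_id|exact: cvg_cst].
have cGe x : continuous (G ^~ x).
  move=> e; apply: cvgM; last exact: cvg_cst.
  apply: cvgD; first by apply: cvgD; [exact: cvg_cst|exact: cvg_id].
  apply: cvgM; last exact: cvg_cst.
  by apply: cvgD; [exact: cvg_cst|exact: cvg_id].
have G_mono e x y : 0 < e -> a <= x -> x <= y -> G e x <= G e y.
  move=> e0 ax xy; apply: ler_pM.
  - by rewrite addr_ge0 ?addr_ge0 ?(ltW e0)// mulr_ge0 ?subr_ge0 ?addr_ge0 ?(ltW e0).
  - exact: expR_ge0.
  - by rewrite lerD2l ler_wpM2l ?addr_ge0 ?(ltW e0)// lerD2r.
  - by rewrite ler_expR ler_wpM2l// lerD2r.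
(* [G e] is a strict supersolution; this comes from [1 + L * h <= expR (L * h)]
   rather than from differentiating [G e]. *)
have G_step e x h : 0 < e -> a <= x -> 0 <= h ->
    G e x + h * (L * G e x + (beta + e)) <= G e (x + h).
  move=> e0 ax h0; rewrite /G.
  set E := expR (L * (x - a)); set K := `|w a| + e + _.
  have -> : L * (x + h - a) = L * (x - a) + L * h by ring.
  rewrite expRD -/E.
  have -> : `|w a| + e + (beta + e) * (x + h - a) = K + (beta + e) * h.
    by rewrite /K; ring.
  have E1 : 1 <= E.
    apply: le_trans (expR_ge1Dx _); rewrite lerDl mulr_ge0// subr_ge0//.
  have F1 : 1 + L * h <= expR (L * h) by exact: expR_ge1Dx.
  have K0 : 0 <= K.
    by rewrite addr_ge0 ?addr_ge0 ?(ltW e0)// mulr_ge0 ?subr_ge0 ?addr_ge0 ?(ltW e0).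
  have be : 0 <= beta + e by rewrite addr_ge0// ltW.
  have bh : 0 <= (beta + e) * h by rewrite mulr_ge0.
  have Lh : 0 <= L * h by rewrite mulr_ge0.
  have KE : 0 <= K * E by apply: mulr_ge0 => //; exact: le_trans ler01 E1.
  apply: le_trans (_ : (K + (beta + e) * h) * (E * (1 + L * h)) <= _); last first.
    apply: ler_wpM2l; first exact: addr_ge0.
    by apply: ler_wpM2l; [exact: le_trans ler01 E1|exact: F1].
  have : (beta + e) * h * 1 <= (beta + e) * h * (E * (1 + L * h)).
    by apply: ler_wpM2l => //; apply: mulr_ege1 => //; rewrite lerDl.
  move=> H1.
  have -> : K * E + h * (L * (K * E) + (beta + e)) =
     K * (E * (1 + L * h)) + (beta + e) * h * 1 by ring.
  by rewrite [leRHS]mulrDl; exact: lerD.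
have GM : \forall e \near 0^'+, G e b < M.
  have : G e b @[e --> 0^'+] --> G 0 b by apply: cvg_at_right_filter; exact: cGe.
  move=> /cvgr_lt; apply.
  by rewrite /G !addr0.
suff H : \forall e \near 0^'+, `|w t| <= G e t.
  have -> : (`|w a| + beta * (t - a)) * expR (L * (t - a)) = lim (G e t @[e --> 0^'+]).
    apply/esym/cvg_lim => //.
    have -> : (`|w a| + beta * (t - a)) * expR (L * (t - a)) = G 0 t.
      by rewrite /G !addr0.
    by apply: cvg_at_right_filter; exact: cGe.
  apply: limr_ge => //; apply/cvg_ex; exists (G 0 t).
  by apply: cvg_at_right_filter; exact: cGe.
near=> e.
have e0 : 0 < e by near: e; exact: nbhs_right_gt.
have GbM : G e b < M by near: e.
rewrite leNgt; apply/negP => wt.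
(* [h] is [`|w| - G e], made continuous on the whole line so that the set [A]
   of points of [a, t] where it is nonpositive is compact; [s] is its last
   point. *)
have at' : {within `[a, t], continuous w}.
  apply: continuous_subspaceW cw => x /=; rewrite !in_itv /= => /andP[-> xt].
  by rewrite (le_trans xt).
pose h x := `|w (clamp a t x)| - G e (clamp a t x).
have ch : continuous h.
  move=> x; apply: cvgB.
    exact: (cvg_norm (continuous_clamp at_ at' (x := x))).
  exact: (continuous_comp (@clamp_continuous _ a t x) (cG e _)).
pose A := `[a, t]%classic `&` [set x | h x <= 0].
have cA : compact A.
  apply: (subclosed_compact _ (@segment_compact _ a t)); last by move=> ? [].
  apply: closedI; first exact: itv_closed.
  by apply: (preimage_closed _ (@closed_le _ 0)) => x _; exact: ch.
have aA : A a.
  split; first by rewrite /= in_itv /= lexx at_.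
  rewrite /= /h clamp_id ?lexx ?at_// /G subrr !mulr0 expR0 mulr1 addr0.
  by rewrite opprD addrA subrr add0r oppr_le0 ltW.
have cid_A : {within A, continuous (id : R -> R)}.
  by apply: continuous_subspaceT => x; exact: cvg_id.
have [s] := @compact_EVT_max R R id A (ex_intro _ a aA) cA cid_A.
rewrite inE => -[]; rewrite /= in_itv /= => /andP[as_ st] hs smax.
have h_gt x : s < x -> x <= t -> 0 < h x.
  move=> sx xt; rewrite ltNge; apply/negP => hx.
  have := smax x; rewrite inE => /(_ _) /=; rewrite leNgt sx => /(_ _)/notF; apply.
  by split => //; rewrite /= in_itv /= xt (le_trans as_ (ltW sx)).
have st' : s < t.
  rewrite lt_neqAle st andbT; apply/eqP => E; move: hs; rewrite E /h clamp_id ?lexx ?at_//.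
  by rewrite subr_le0 leNgt wt.
have ats : a <= s <= t by rewrite as_ st.
have ws : `|w s| <= G e s by move: hs; rewrite /h clamp_id// subr_le0.
have ltxt : \forall x \near s^'+, x <= t.
  by apply: nbhs_right_le.
(* At the left end nothing is known on the derivative, but [h a < 0] and
   continuity suffice. *)
have [as'|sa] := ltP a s; last first.
  have sE : s = a by apply/eqP; rewrite eq_le sa as_.
  have ha : h a < 0.
    rewrite /h clamp_id ?lexx ?at_// /G subrr !mulr0 expR0 mulr1 addr0.
    by rewrite opprD addrA subrr add0r oppr_lt0.
  have : \forall x \near a^'+, h x < 0.
    have : h x @[x --> a^'+] --> h a by apply: cvg_at_right_filter; exact: ch.
    by move=> /cvgr_lt; apply.
  move=> nh.
  have [x [hx0 [ax xt]]] : exists x, h x < 0 /\ a < x /\ x <= t.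
    apply: (@filter_ex _ a^'+).
    rewrite -sE in nh *; near=> x; split; first by near: x.
    split; near: x => //; exact: nbhs_right_gt.
  have := h_gt x; rewrite sE => /(_ ax xt); rewrite ltNge ltW//.
have wsM : `|w s| <= M.
  apply: le_trans ws _; apply: le_trans (ltW GbM); apply: G_mono => //.
  exact: le_trans st tb.
have [|rw wb] := wd s _ wsM; first by rewrite as' (lt_le_trans st').
have nw := rderiv_norm_le rw e0.
have [x [sx [xt wx]]] : exists x, s < x /\ x <= t /\
    `|w x| <= `|w s| + (x - s) * (`|w' s| + e).
  apply: (@filter_ex _ s^'+); near=> x; split; first by near: x; exact: nbhs_right_gt.
  by split; near: x.
have := h_gt x sx xt; rewrite /h clamp_id ?xt ?(ltW (lt_trans as' sx))//.
rewrite subr_gt0 ltNge => /negP; apply.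
apply: le_trans wx _.
have xs0 : 0 <= x - s by rewrite subr_ge0 ltW.
have := G_step e s (x - s) e0 as_ xs0; rewrite [s + _]addrC subrK.
apply: le_trans; apply: lerD => //; rewrite ler_wpM2l// addrA lerD2r.
by apply: le_trans wb _; rewrite lerD2r ler_wpM2l.
Unshelve. all: by end_near. Qed.

Lemma rderivB (R : realType) (V : normedModType R) (w1 w2 : R -> V) s d1 d2 :
  rderiv w1 s d1 -> rderiv w2 s d2 -> rderiv (w1 \- w2) s (d1 - d2).
Proof.
move=> H1 H2.
have E x : (x - s)^-1 *: ((w1 \- w2) x - (w1 \- w2) s) =
    (x - s)^-1 *: (w1 x - w1 s) - (x - s)^-1 *: (w2 x - w2 s).
  rewrite -scalerBr /= !opprB addrACA [in RHS]addrACA.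
  by congr (_ *: (_ + _)); rewrite addrC.
by rewrite /rderiv; under eq_fun do rewrite E; exact: cvgB.
Qed.

Lemma rderiv_scale (R : realType) (V : normedModType R) (c : V) (s : R) :
  rderiv (fun x : R => x *: c) s c.
Proof.
rewrite /rderiv; apply: (@cvg_trans _ (c @[x --> s^'+])); last exact: cvg_cst.
apply: near_eq_cvg; near=> x; rewrite -scalerBl scalerA mulVf ?scale1r//.
by rewrite subr_eq0; near: x; exact: nbhs_right_neq.
Unshelve. all: by end_near. Qed.

Lemma rderiv_cst (R : realType) (V : normedModType R) (c : V) (s : R) :
  rderiv (fun=> c) s 0.
Proof.
rewrite /rderiv; apply: (@cvg_trans _ ((0 : V) @[x --> s^'+])); last exact: cvg_cst.
by apply: near_eq_cvg; near=> x; rewrite subrr scaler0.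
Unshelve. all: by end_near. Qed.

(** Gronwall without the linear term, applied to [w - w a]. *)
Lemma mean_value_rderiv_norm_le (R : realType) (V : normedModType R)
    (w w' : R -> V) (a b beta : R) :
  a <= b -> 0 <= beta -> {within `[a, b], continuous w} ->
  (forall s, a < s < b -> rderiv w s (w' s) /\ `|w' s| <= beta) ->
  `|w b - w a| <= beta * (b - a).
Proof.
move=> ab beta0 cw wd.
have cwa : {within `[a, b], continuous (fun x => w x - w a)}.
  apply: within_continuousB => //.
  by apply: continuous_subspaceT => x; exact: cvg_cst.
have := @gronwall_rderiv R V (fun x => w x - w a) (fun x => w' x - 0) a b 0 beta
  (beta * (b - a) + 1) (lexx _) beta0 cwa _ _ b.
rewrite subrr normr0 add0r !mul0r expR0 !mulr1 ab lexx; apply => //.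
  by rewrite ltrDl.
move=> s /wd[rw wb] _; rewrite mul0r add0r subr0; split=> //.
by rewrite -[w' s]subr0; apply: rderivB => //; exact: rderiv_cst.
Qed.

Lemma cvg_shift_at_right (R : realType) (s : R) :
  x - s @[x --> s^'+] --> (0:R)^'.
Proof.
move=> A; rewrite /dnbhs /within /= => HA; rewrite nbhs_simpl.
have /(_ _ HA) : x - s @[x --> s^'+] --> (0:R).
  apply: cvg_at_right_filter; rewrite -(subrr s).
  by apply: cvgB; [exact: cvg_id|exact: cvg_cst].
rewrite nbhs_simpl /= => H; near=> x.
have : (x - s != 0 -> A (x - s)) by near: x.
apply; rewrite subr_eq0; near: x; exact: nbhs_right_neq.
Unshelve. all: by end_near. Qed.

(** A directional derivative is in particular a right derivative along the
    line, which lets the mean value inequality act on functions of several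
    variables. *)
Lemma rderiv_line (R : realType) (V W : normedModType R) (h : V -> W)
    (q p : V) (s : R) :
  derivable h (q + s *: p) p ->
  rderiv (fun x => h (q + x *: p)) s ('D_p h (q + s *: p)).
Proof.
move=> dh.
have H : k^-1 *: (h (k *: p + (q + s *: p)) - h (q + s *: p)) @[k --> 0^'] -->
   'D_p h (q + s *: p) by exact: dh.
rewrite /rderiv.
have := cvg_comp _ _ (@cvg_shift_at_right R s) H.
apply: cvg_trans; apply: near_eq_cvg; near=> x => /=.
by rewrite addrCA -scalerDl subrK.
Unshelve. all: by end_near. Qed.

Lemma rderiv_shift (R : realType) (V : normedModType R) (w : R -> V) s c d :
  rderiv w (s - c) d -> rderiv (fun x => w (x - c)) s d.
Proof.
move=> H; rewrite /rderiv.
have sub : x - c @[x --> s^'+] --> (s - c)^'+.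
  move=> P; rewrite /at_right /within /= => HP; rewrite nbhs_simpl /=.
  have sx : z - c @[z --> s] --> s - c.
    by apply: cvgB; [exact: cvg_id|exact: cvg_cst].
  have := sx _ HP; rewrite nbhs_simpl /=; apply: filterS => z /= Hz sz.
  by apply: Hz; rewrite ltrD2r.
have := cvg_comp _ _ sub H; apply: cvg_trans; apply: near_eq_cvg.
near=> x => /=; rewrite (_ : x - c - (s - c) = x - s)//.
by rewrite opprB addrA subrK.
Unshelve. all: by end_near. Qed.

Lemma within_continuous_shift (R : realType) (T : topologicalType) (a b c : R)
    (w : R -> T) :
  {within `[a - c, b - c], continuous w} ->
  {within `[a, b], continuous (fun x => w (x - c))}.
Proof.
move=> /subspace_continuousP cw; apply/subspace_continuousP => x.
rewrite /= in_itv /= => /andP[ax xb].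
have xc : `[a - c, b - c]%classic (x - c) by rewrite /= in_itv /= !lerD2r ax xb.
move=> P /(cw _ xc); rewrite nbhs_simpl /= /within /= => H.
have sx : z - c @[z --> x] --> x - c.
  by apply: cvgB; [exact: cvg_id|exact: cvg_cst].
have := sx _ H; rewrite nbhs_simpl /=; apply: filterS => z /= Hz.
rewrite in_itv /= => /andP[az zb]; apply: Hz.
by rewrite in_itv /= !lerD2r az zb.
Qed.

Lemma derivative_within_rderiv (R : realType) (V : normedModType R) (a b : R)
    (g : R -> V) (t : R) (d : V) :
  derivative_within `[a, b] g t d -> a <= t < b -> rderiv g t d.
Proof.
move=> dg /andP[at_ tb]; apply: cvg_trans dg; apply: cvg_app => P.
rewrite /within /dnbhs /within /= => HP.
change (\forall x \near t, t < x -> P x).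
have tlb : \forall x \near t, x < b by exact: lt_nbhsl.
near=> x => tx.
have Px : x != t -> `[a, b]%classic x -> P x by near: x.
have xb : x < b by near: x.
by apply: Px; rewrite ?gt_eqF//= in_itv /= (le_trans at_ (ltW tx)) ltW.
Unshelve. all: by end_near. Qed.

Lemma derivative_within_continuous (R : realType) (V : normedModType R)
    (a b : R) (g dg : R -> V) :
  (forall t, a <= t <= b -> derivative_within `[a, b] g t (dg t)) ->
  {within `[a, b], continuous g}.
Proof.
move=> Hg; apply/subspace_continuousP => t; rewrite /= in_itv /= => tab.
have t0 : s - t @[s --> t] --> (0 : R).
  by rewrite -(subrr t); apply: cvgB; [exact: cvg_id|exact: cvg_cst].
have H0 : (s - t) *: ((s - t)^-1 *: (g s - g t)) @[s --> within `[a, b] t^'] --> (0 : V).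
  rewrite -(scale0r (dg t)); apply: cvgZ; last exact: Hg.
  by apply: cvg_within_filter; apply: cvg_within_filter; exact: t0.
apply/cvgrPdist_lt => /= e e0.
move/cvgrPdist_lt : H0 => /(_ e e0); rewrite /dnbhs /within /= => H.
change (\forall x \near t, `[a, b]%classic x -> `|g t - g x| < e).
near=> x => xab.
have [->|xt] := eqVneq x t; first by rewrite subrr normr0.
have : x != t -> `[a, b]%classic x -> `|0 - (x - t) *: ((x - t)^-1 *: (g x - g t))| < e.
  by near: x.
move=> /(_ xt xab); rewrite scalerA mulfV ?subr_eq0// scale1r sub0r normrN.
by rewrite distrC.
Unshelve. all: by end_near. Qed.

Lemma within_continuous_bounded (R : realType) (V : normedModType R) (a b : R)
    (w : R -> V) :
  {within `[a, b], continuous w} ->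
  exists B, forall x, a <= x <= b -> `|w x| <= B.
Proof.
move=> cw; have [M [_ HM]] := compact_bounded (continuous_compact cw (@segment_compact _ a b)).
exists (M + 1) => x xab; apply: (HM (M + 1)); first by rewrite ltrDl.
by exists x => //; rewrite /= in_itv.
Qed.

(** * Norms of vectors and matrices *)

Lemma mx_norm_le (R : realType) (m n : nat) (M : 'M[R]_(m, n)) (c : R) :
  0 <= c -> (forall i j, `|M i j| <= c) -> `|M| <= c.
Proof.
move=> c0 H; rewrite [leLHS]/Num.Def.normr/= mx_normrE.
by apply: bigmax_le => // -[i j] _ /=.
Qed.

Lemma mx_entry_le (R : realType) (m n : nat) (M : 'M[R]_(m, n)) i j :
  `|M i j| <= `|M|.
Proof.
rewrite [leRHS]/Num.Def.normr/= mx_normrE.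
exact: (le_bigmax _ (fun ij : 'I_m * 'I_n => `|M ij.1 ij.2|) (i, j)).
Qed.

Lemma mulmx_norm_le (R : realType) (m n p : nat) (A : 'M[R]_(m, n))
    (B : 'M[R]_(n, p)) : `|A *m B| <= n%:R * `|A| * `|B|.
Proof.
apply: mx_norm_le => [|i j]; first by rewrite !mulr_ge0.
rewrite mxE; apply: le_trans (ler_norm_sum _ _ _) _.
apply: le_trans (_ : \sum_(k < n) `|A| * `|B| <= _).
  by apply: ler_sum => k _; rewrite normrM ler_pM ?mx_entry_le.
by rewrite sumr_const card_ord -mulrA mulr_natl.
Qed.

Lemma cvg_mxP (R : realType) (m n : nat) (T : Type) (F : set_system T)
    {FF : Filter F} (M : T -> 'M[R]_(m, n)) (l : 'M[R]_(m, n)) :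
  (forall i j, M x i j @[x --> F] --> l i j) -> M x @[x --> F] --> l.
Proof.
move=> H; apply/cvgrPdist_le => /= e e0.
near=> x; apply: mx_norm_le => [|i j]; first exact: ltW.
rewrite !mxE; move: i j; near: x.
apply: filter_forall => i; apply: filter_forall => j.
by have /cvgrPdist_le/(_ _ e0) := H i j.
Unshelve. all: by end_near. Qed.

Lemma cvg_mx_entry (R : realType) (m n : nat) (T : Type) (F : set_system T)
    {FF : Filter F} (M : T -> 'M[R]_(m, n)) (l : 'M[R]_(m, n)) i j :
  M x @[x --> F] --> l -> M x i j @[x --> F] --> l i j.
Proof. by move=> H; exact: (continuous_cvg _ (@coord_continuous _ m n i j l) H). Qed.

Lemma cvg_mulmx (R : realType) (m n p : nat) (T : Type) (F : set_system T)
    {FF : Filter F} (A : T -> 'M[R]_(m, n)) (B : T -> 'M[R]_(n, p))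
    (a : 'M[R]_(m, n)) (b : 'M[R]_(n, p)) :
  A x @[x --> F] --> a -> B x @[x --> F] --> b ->
  A x *m B x @[x --> F] --> a *m b.
Proof.
move=> Aa Bb; apply: cvg_mxP => i j; rewrite mxE.
under eq_fun do rewrite mxE.
by apply: cvg_big => [|k _]; [exact: add_continuous|apply: cvgM; exact: cvg_mx_entry].
Qed.

(** Closed balls are compact in finite dimension.  The proof works with row
    vectors and transports the result by transposition, which is continuous. *)
Lemma cV_bounded (R : realType) (m : nat) (W : normedModType R)
    (g : 'cV[R]_m * 'cV[R]_m -> W) (B : R) :
  continuous g ->
  exists M : R, forall z w, `|z| <= B -> `|w| <= B -> `|g (z, w)| <= M.
Proof.
move=> cg; pose K : set 'rV[R]_m := [set v | `|v| <= B].
have cK : compact K.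
  apply: bounded_closed_compact.
    exists B; split; first exact: num_real.
    by move=> x Bx v /= vB; apply: le_trans vB (ltW Bx).
  apply: (preimage_closed _ (@closed_le _ B)) => v _.
  exact: norm_continuous.
have ctr : continuous (trmx : 'rV[R]_m -> 'cV[R]_m).
  move=> v; apply: (@cvg_mxP R m 1 _ (nbhs v)) => i j; rewrite mxE; under eq_fun do rewrite mxE.
  exact: coord_continuous.
pose h (p : 'rV[R]_m * 'rV[R]_m) := g (p.1^T, p.2^T).
have ch : continuous h.
  move=> p; apply: (@continuous_comp _ _ _ (fun p => (p.1^T, p.2^T)) g); last exact: cg.
  apply: (@cvg_pair _ _ _ (nbhs p) (nbhs (p.1^T : 'cV_m)) (nbhs (p.2^T : 'cV_m))).
    by apply: (@continuous_comp _ _ _ fst trmx); [exact: cvg_fst|exact: ctr].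
  by apply: (@continuous_comp _ _ _ snd trmx); [exact: cvg_snd|exact: ctr].
have [M [_ HM]] := compact_bounded (continuous_compact
  (continuous_subspaceT ch (A := K `*` K)) (compact_setX cK cK)).
exists (M + 1) => z w zB wB.
have ntr (v : 'cV[R]_m) : `|v| <= B -> `|v^T| <= B.
  move=> vB; apply: mx_norm_le => [|i j]; first exact: le_trans vB.
  by rewrite mxE; apply: le_trans (mx_entry_le _ _ _) vB.
apply: HM; first by rewrite ltrDl.
exists (z^T, w^T); last by rewrite /h /= !trmxK.
by split; exact: ntr.
Qed.

Lemma vector_norm0 (R : realType) (m : nat) (N : 'cV[R]_m -> R) :
  vector_norm N -> N 0 = 0.
Proof. by case=> _ NZ _; rewrite -(scale0r (0 : 'cV_m)) NZ normr0 mul0r. Qed.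

Lemma vector_norm_ge0 (R : realType) (m : nat) (N : 'cV[R]_m -> R) v :
  vector_norm N -> 0 <= N v.
Proof.
move=> Nn; have N0 := vector_norm0 Nn; case: Nn => ND NZ _.
have := ND v (- v); rewrite subrr N0 -scaleN1r NZ normrN1 mul1r => H.
by have : 0 <= N v *+ 2; [rewrite mulr2n|rewrite pmulrn_lge0].
Qed.

(** Expand a vector in the standard basis. *)
Lemma vector_norm_le (R : realType) (m : nat) (N : 'cV[R]_m -> R) :
  vector_norm N -> exists2 c, 0 < c & forall v, N v <= c * `|v|.
Proof.
move=> Nn; have N0 := vector_norm0 Nn.
have Nge v := vector_norm_ge0 v Nn; case: Nn => ND NZ _.
exists (\sum_(i < m) N (delta_mx i 0) + 1).
  by rewrite ltr_wpDl// sumr_ge0.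
move=> v; rewrite mulrDl mul1r -[leLHS]addr0 lerD//.
rewrite {1}(matrix_sum_delta v).
under eq_bigr do rewrite big_ord1.
rewrite mulr_suml.
elim/big_ind2 : _ => [|x1 x2 y1 y2 h1 h2|i _]; first by rewrite N0.
  by apply: le_trans (ND _ _) _; exact: lerD.
by rewrite NZ mulrC ler_wpM2l// mx_entry_le.
Qed.

(** [N] is continuous by [vector_norm_le], hence has a positive minimum on the
    compact unit sphere of the maximum norm.  The sphere is empty when [m = 0]. *)
Lemma vector_norm_ge (R : realType) (m : nat) (N : 'cV[R]_m -> R) :
  vector_norm N -> exists2 d, 0 < d & forall v, `|v| <= d * N v.
Proof.
move=> Nn; have [c c0 Nc] := vector_norm_le Nn; have N0 := vector_norm0 Nn.
have Nge v := vector_norm_ge0 v Nn; case: Nn => ND NZ Nd.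
pose K : set 'rV[R]_m := [set v | `|v| = 1].
have cK : compact K.
  apply: bounded_closed_compact.
    exists 1; split; first exact: num_real.
    by move=> x Bx v /= ->; exact: ltW.
  rewrite (_ : K = (fun v : 'rV[R]_m => `|v|) @^-1` [set 1]); last by [].
  apply: (preimage_closed _ (@closed_eq _ 1)) => v _.
  exact: norm_continuous.
have ntr (v : 'rV[R]_m) : `|v^T| = `|v|.
  have H p q (A : 'M[R]_(p, q)) : `|A^T| <= `|A|.
    by apply: mx_norm_le => // i j; rewrite mxE mx_entry_le.
  by apply/eqP; rewrite eq_le H -{1}(trmxK v) H.
have NB u v : `|N u - N v| <= c * `|u - v|.
  have H x z : N x - N z <= c * `|x - z|.
    rewrite lerBlDr; apply: le_trans (_ : N (x - z) + N z <= _); last by rewrite lerD2r.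
    by apply: le_trans (ND _ _); rewrite subrK.
  by rewrite ler_norml H andbT lerNl opprB distrC H.
pose h (v : 'rV[R]_m) := N v^T.
have ch : continuous h.
  move=> v; apply/(@cvgrPdist_le _ _ _ (nbhs v)) => /= e e0; near=> w.
  rewrite /h; apply: le_trans (NB _ _) _.
  rewrite -linearB /= ntr -ler_pdivlMl// mulrC.
  near: w; apply: (@cvgr_dist_le _ _ _ (nbhs v) _ id v); first exact: cvg_id.
  exact: divr_gt0.
have [K0|/set0P[k Kk]] := eqVneq K set0.
  exists 1 => // v; have [->|v0] := eqVneq v 0; first by rewrite normr0 N0 mulr0.
  exfalso; have : K (`|v|^-1 *: v^T).
    rewrite /K /= normrZ -ntr trmxK normfV normr_id mulVf// normr_eq0//.
  by rewrite K0.
have [k0 k0K kmin] := compact_EVT_min (ex_intro _ k Kk) cK (continuous_subspaceT ch).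
have hk : 0 < h k0.
  rewrite lt_neqAle Nge andbT eq_sym; apply/eqP => /Nd /(congr1 (@Num.norm _ _)).
  rewrite ntr normr0; move: k0K; rewrite inE /K /= => -> /eqP; by rewrite oner_eq0.
exists (h k0)^-1; first by rewrite invr_gt0.
move=> v; rewrite ler_pdivlMl//.
have [->|v0] := eqVneq v 0; first by rewrite normr0 mulr0 N0.
have nv : 0 < `|v| by rewrite normr_gt0.
have := kmin (`|v|^-1 *: v^T).
rewrite inE /K /= normrZ -ntr trmxK normfV normr_id mulVf ?gt_eqF// => /(_ erefl).
by rewrite /h linearZ /= trmxK NZ normfV normr_id ler_pdivlMl// mulrC.
Unshelve. all: by end_near. Qed.

Lemma rderiv_mulmxr (R : realType) (m n p : nat) (w : R -> 'M[R]_(m, n)) s d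
    (C : 'M[R]_(n, p)) :
  rderiv w s d -> rderiv (fun x => w x *m C) s (d *m C).
Proof.
move=> H; rewrite /rderiv; under eq_fun do rewrite -mulmxBl scalemxAl.
apply: (@cvg_mulmx _ _ _ _ _ _ _ _ (fun=> C)) => //; exact: cvg_cst.
Qed.

(** * Second-order expansion of the right-hand side *)

(** Taking [c = 0] gives the usual mean value inequality.  Taking
    [c = 'D_p h q] bounds the error of the first-order expansion by the
    oscillation of ['D_p h] along the segment. *)
Lemma mean_value_norm_le (R : realType) (V W : normedModType R) (h : V -> W)
    (q p : V) (c : W) (M : R) :
  (forall x, differentiable h x) ->
  (forall s, 0 <= s <= 1 -> `|'D_p h (q + s *: p) - c| <= M) ->
  `|h (q + p) - h q - c| <= M.
Proof.
move=> dh HM.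
have M0 : 0 <= M by apply: le_trans (HM 0 _); rewrite ?lexx ?ler01.
pose w (x : R) := h (q + x *: p) - x *: c.
have cw : continuous w.
  move=> x; apply: cvgB; last by apply: cvgZr_tmp; exact: cvg_id.
  apply: continuous_cvg; first exact: differentiable_continuous.
  by apply: cvgD; [exact: cvg_cst|apply: cvgZr_tmp; exact: cvg_id].
have := @mean_value_rderiv_norm_le R W w (fun s => 'D_p h (q + s *: p) - c) 0 1 M
  ler01 M0 (continuous_subspaceT cw).
rewrite /w !scale1r !scale0r addr0 !subr0 mulr1 [h (q + p) - c - _]addrAC; apply.
move=> s /andP[s0 s1]; split; last by rewrite HM// !ltW.
apply: rderivB; last exact: rderiv_scale.
by apply: rderiv_line; exact: diff_derivable.
Qed.

(** Compactness bounds each of the finitely many derivatives along basis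
    vectors; this formula turns these into a bound for all directions at once. *)
Lemma derive_pairE (R : realType) (m : nat) (W : normedModType R)
    (h : 'cV[R]_m * 'cV[R]_m -> W) x (p : 'cV[R]_m * 'cV[R]_m) :
  differentiable h x ->
  'D_p h x = \sum_j p.1 j 0 *: 'D_(delta_mx j 0, 0) h x
           + \sum_j p.2 j 0 *: 'D_(0, delta_mx j 0) h x.
Proof.
move=> dh; rewrite deriveE//.
pose S1 := \sum_j p.1 j 0 *: ((delta_mx j 0, 0) : 'cV[R]_m * 'cV[R]_m).
pose S2 := \sum_j p.2 j 0 *: ((0, delta_mx j 0) : 'cV[R]_m * 'cV[R]_m).
have pE : p = S1 + S2.
  have fstE (F : 'I_m -> 'cV[R]_m * 'cV[R]_m) : (\sum_j F j).1 = \sum_j (F j).1.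
    by rewrite (big_morph fst (id1 := 0) (op1 := +%R)).
  have sndE (F : 'I_m -> 'cV[R]_m * 'cV[R]_m) : (\sum_j F j).2 = \sum_j (F j).2.
    by rewrite (big_morph snd (id1 := 0) (op1 := +%R)).
  have colE (v : 'cV[R]_m) : v = \sum_j v j 0 *: delta_mx j 0.
    rewrite {1}(matrix_sum_delta v); apply: eq_bigr => j _.
    by rewrite big_ord1.
  have ES1 : S1 = (p.1, 0).
    rewrite [LHS]surjective_pairing fstE sndE /=.
    rewrite (colE p.1); congr (_, _); last by apply: big1 => j _; exact: scaler0.
    by rewrite -colE.
  have ES2 : S2 = (0, p.2).
    rewrite [LHS]surjective_pairing fstE sndE /=.
    rewrite (colE p.2); congr (_, _); first by apply: big1 => j _; exact: scaler0.
    by rewrite -colE.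
  rewrite ES1 ES2 [LHS]surjective_pairing.
  by rewrite -[RHS]/(p.1 + 0, 0 + p.2) addr0 add0r.
rewrite [X in 'd h x X]pE linearD /S1 /S2 !linear_sum /=; congr (_ + _); apply: eq_bigr => j _.
  by rewrite linearZ deriveE.
by rewrite linearZ deriveE.
Qed.

Lemma pair_comb_norm_le (R : realType) (m : nat) (W : normedModType R)
    (p : 'cV[R]_m * 'cV[R]_m) (a b : 'I_m -> W) (M : R) :
  (forall j, `|a j| <= M) -> (forall j, `|b j| <= M) ->
  `|\sum_j p.1 j 0 *: a j + \sum_j p.2 j 0 *: b j| <= (m + m)%:R * `|p| * M.
Proof.
move=> aM bM.
have H (v : 'cV[R]_m) (c : 'I_m -> W) : `|v| <= `|p| -> (forall j, `|c j| <= M) ->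
    `|\sum_j v j 0 *: c j| <= m%:R * `|p| * M.
  move=> vp cM; apply: le_trans (ler_norm_sum _ _ _) _.
  apply: le_trans (_ : \sum_(j < m) `|p| * M <= _).
    apply: ler_sum => j _; rewrite normrZ ler_pM// (le_trans _ vp)//.
    exact: mx_entry_le.
  by rewrite sumr_const card_ord -mulrA mulr_natl.
apply: le_trans (ler_normD _ _) _.
rewrite natrD !mulrDl; apply: lerD; apply: H => //.
  by rewrite prod_normE le_max lexx.
by rewrite prod_normE le_max lexx orbT.
Qed.

Lemma pair_comb_dist_le (R : realType) (m : nat) (W : normedModType R)
    (p : 'cV[R]_m * 'cV[R]_m) (a a' b b' : 'I_m -> W) (M : R) :
  (forall j, `|a j - a' j| <= M) -> (forall j, `|b j - b' j| <= M) ->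
  `|\sum_j p.1 j 0 *: a j + \sum_j p.2 j 0 *: b j
    - (\sum_j p.1 j 0 *: a' j + \sum_j p.2 j 0 *: b' j)|
    <= (m + m)%:R * `|p| * M.
Proof.
move=> aM bM; rewrite opprD addrACA -sumrB -sumrB.
rewrite (eq_bigr (fun j => p.1 j 0 *: (a j - a' j))) => [|j _]; last by rewrite scalerBr.
rewrite [X in _ + X](eq_bigr (fun j => p.2 j 0 *: (b j - b' j))) => [|j _].
  exact: pair_comb_norm_le.
by rewrite scalerBr.
Qed.

Lemma F1E (R : realType) (m : nat) (f : 'cV[R]_m -> 'cV[R]_m -> 'cV[R]_m) z w i j :
  F1 f z w i j = ('D_(delta_mx j 0, 0) (fun p => f p.1 p.2) (z, w)) i 0.
Proof.
have E : 'D_(delta_mx j 0) (fun z' => f z' w) z =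
    'D_(delta_mx j 0, 0) (fun p => f p.1 p.2) (z, w).
  rewrite /derive; do 2 f_equal; apply/funext => k /=.
  by rewrite scaler0 add0r.
by rewrite mxE E.
Qed.

Lemma F2E (R : realType) (m : nat) (f : 'cV[R]_m -> 'cV[R]_m -> 'cV[R]_m) z w i j :
  F2 f z w i j = ('D_(0, delta_mx j 0) (fun p => f p.1 p.2) (z, w)) i 0.
Proof.
have E : 'D_(delta_mx j 0) (fun w' => f z w') w =
    'D_(0, delta_mx j 0) (fun p => f p.1 p.2) (z, w).
  rewrite /derive; do 2 f_equal; apply/funext => k /=.
  by rewrite scaler0 add0r.
by rewrite mxE E.
Qed.

Lemma derive_F12 (R : realType) (m : nat)
    (f : 'cV[R]_m -> 'cV[R]_m -> 'cV[R]_m) z w h k :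
  differentiable (fun p : 'cV[R]_m * 'cV[R]_m => f p.1 p.2) (z, w) ->
  'D_(h, k) (fun p => f p.1 p.2) (z, w) = F1 f z w *m h + F2 f z w *m k.
Proof.
move=> df; rewrite derive_pairE//=; congr (_ + _); apply/colP => i;
  rewrite mxE summxE; apply: eq_bigr => j _; rewrite mxE mulrC.
  by rewrite F1E.
by rewrite F2E.
Qed.

Lemma cvg_F2 (R : realType) (m : nat) (f : 'cV[R]_m -> 'cV[R]_m -> 'cV[R]_m)
    (T : Type) (F : set_system T) {FF : Filter F} (z w : T -> 'cV[R]_m) z0 w0 :
  class_C 2 (fun p : 'cV[R]_m * 'cV[R]_m => f p.1 p.2) ->
  z x @[x --> F] --> z0 -> w x @[x --> F] --> w0 ->
  F2 f (z x) (w x) @[x --> F] --> F2 f z0 w0.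
Proof.
move=> [_ C1] zz ww; apply: cvg_mxP => i j; rewrite F2E.
under eq_fun do rewrite F2E.
apply: cvg_mx_entry.
have cD : continuous ('D_(0, delta_mx j 0) (fun p : 'cV[R]_m * 'cV[R]_m => f p.1 p.2)).
  by move=> x; apply: differentiable_continuous; exact: (C1 _).1.
apply: (continuous_cvg _ (cD (z0, w0))).
exact: (@cvg_pair _ _ _ F (nbhs z0) (nbhs w0)).
Qed.

Lemma cV_family_bounded (R : realType) (m : nat) (W : normedModType R)
    (I : finType) (g : I -> 'cV[R]_m * 'cV[R]_m -> W) (B : R) :
  (forall i, continuous (g i)) ->
  exists2 M : R, 0 <= M &
    forall i z w, `|z| <= B -> `|w| <= B -> `|g i (z, w)| <= M.
Proof.
move=> cg; have [M HM] := choice (fun i => cV_bounded B (cg i)).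
exists (\sum_i `|M i|) => [|i z w zB wB]; first exact: sumr_ge0.
apply: le_trans (HM i z w zB wB) _; apply: le_trans (ler_norm _) _.
by rewrite (bigD1 i)//= lerDl sumr_ge0.
Qed.

(** On the ball of radius [B + 1] the first and second partial derivatives are
    bounded, by compactness.  The mean value inequality for [f] gives the
    Lipschitz bound; for the partial derivatives of [f] it shows that they are
    Lipschitz, which bounds the oscillation of ['D_p f] along the segment by a
    multiple of [`|p| ^+ 2] and so gives the second-order expansion. *)
Lemma class_C2_local_bounds (R : realType) (m : nat)
    (f : 'cV[R]_m -> 'cV[R]_m -> 'cV[R]_m) (B : R) :
  class_C 2 (fun p : 'cV[R]_m * 'cV[R]_m => f p.1 p.2) ->
  exists2 K : R, 0 <= K & forall z w h k,
    `|z| <= B -> `|w| <= B -> `|h| <= 1 -> `|k| <= 1 ->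
    [/\ `|F1 f z w| <= K, `|F2 f z w| <= K,
        `|f (z + h) (w + k) - f z w| <= K * (`|h| + `|k|)
      & `|f (z + h) (w + k) - f z w - (F1 f z w *m h + F2 f z w *m k)|
          <= K * (`|h| + `|k|) ^+ 2].
Proof.
set F := (fun p => f p.1 p.2) => -[dF C1].
pose e (i : 'I_m + 'I_m) : 'cV[R]_m * 'cV[R]_m :=
  match i with inl j => (delta_mx j 0, 0) | inr j => (0, delta_mx j 0) end.
have cD1 i : continuous ('D_(e i) F).
  by move=> x; apply: differentiable_continuous; exact: (C1 (e i)).1.
have [M1 M10 HM1] := @cV_family_bounded R m _ _ (fun i => 'D_(e i) F) (B + 1) cD1.
have [M2 M20 HM2] := @cV_family_bounded R m _ (('I_m + 'I_m) * ('I_m + 'I_m))%type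
  (fun i => 'D_(e i.2) ('D_(e i.1) F)) (B + 1) (fun i => (C1 (e i.1)).2 (e i.2)).
pose c : R := (m + m)%:R.
exists (M1 + c * M1 + c * (c * M2)); first by rewrite !addr_ge0 ?mulr_ge0.
have c0 : 0 <= c by exact: ler0n.
have cM1 : 0 <= c * M1 by rewrite mulr_ge0.
have ccM2 : 0 <= c * (c * M2) by rewrite !mulr_ge0.
move=> z w h k zB wB h1 k1.
set K := _ + _ + _.
have M1K : M1 <= K by rewrite /K -addrA lerDl addr_ge0.
have cM1K : c * M1 <= K by rewrite /K [M1 + _]addrC -addrA lerDl addr_ge0.
have ccM2K : c * (c * M2) <= K by rewrite /K lerDr addr_ge0.
have BB : B <= B + 1 by rewrite lerDl.
pose q := (z, w); pose p := (h, k).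
have p_le : `|p| <= `|h| + `|k|.
  by rewrite prod_normE /= ge_max lerDl lerDr !normr_ge0.
have seg s : 0 <= s <= 1 -> `|z + s *: h| <= B + 1 /\ `|w + s *: k| <= B + 1.
  move=> /andP[s0 s1]; split; apply: le_trans (ler_normD _ _) _; apply: lerD => //;
    by rewrite normrZ ger0_norm// mulr_ile1.
have comb (g : 'cV[R]_m * 'cV[R]_m -> 'cV[R]_m) x M : differentiable g x ->
    (forall i, `|'D_(e i) g x| <= M) -> `|'D_p g x| <= c * `|p| * M.
  move=> dg HM; rewrite derive_pairE//; apply: pair_comb_norm_le => j.
    exact: (HM (inl j)).
  exact: (HM (inr j)).
(* Mean value inequality on the segment from [q] to [q + s *: p], on which
   the second partial derivatives are bounded by [M2]. *)
have D1_lip i s : 0 <= s <= 1 ->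
    `|'D_(e i) F (q + s *: p) - 'D_(e i) F q| <= c * `|p| * M2.
  move=> /andP[s0 s1].
  have := @mean_value_norm_le R _ _ ('D_(e i) F) q (s *: p) 0 (c * `|p| * M2).
  rewrite subr0; apply; first exact: (C1 (e i)).1.
  move=> u /andP[u0 u1]; rewrite subr0 deriveE; last exact: (C1 (e i)).1.
  rewrite linearZ /= normrZ -deriveE; last exact: (C1 (e i)).1.
  have us : 0 <= u * s <= 1 by rewrite mulr_ge0//= mulr_ile1.
  rewrite ger0_norm// -[leRHS]mul1r; apply: ler_pM => //.
  apply: comb; first exact: (C1 (e i)).1.
  move=> i'; rewrite scalerA.
  have [H1 H2] := seg _ us.
  exact: (HM2 (i, i')).
split.
- apply: mx_norm_le => [|i j]; first exact: le_trans M1K.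
  rewrite F1E; apply: le_trans (mx_entry_le _ _ _) _; apply: le_trans M1K.
  by apply: (HM1 (inl j)); [exact: le_trans zB BB|exact: le_trans wB BB].
- apply: mx_norm_le => [|i j]; first exact: le_trans M1K.
  rewrite F2E; apply: le_trans (mx_entry_le _ _ _) _; apply: le_trans M1K.
  by apply: (HM1 (inr j)); [exact: le_trans zB BB|exact: le_trans wB BB].
- have := @mean_value_norm_le R _ _ F q p 0 (c * `|p| * M1) dF.
  rewrite subr0 => H; apply: (le_trans (H _)).
    move=> s /seg[H1 H2]; rewrite subr0; apply: comb; first exact: dF.
    by move=> i; exact: HM1.
  by rewrite mulrAC ler_pM// ?mulr_ge0.
- rewrite -derive_F12; last exact: dF.
  have H := @mean_value_norm_le R _ _ F q p ('D_p F q) (c * `|p| * (c * `|p| * M2)) dF.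
  apply: (le_trans (H _)).
    move=> s s01; rewrite !derive_pairE; [|exact: dF|exact: dF].
    apply: pair_comb_dist_le => j.
      exact: (D1_lip (inl j)).
    exact: (D1_lip (inr j)).
  rewrite (_ : _ * _ = c * (c * M2) * `|p| ^+ 2); last by ring.
  by rewrite ler_pM// ?sqr_ge0// lerXn2r// nnegrE// addr_ge0.
Qed.

(** * Fundamental solutions of linear equations *)

(** With [X a = 0] this is uniqueness for the linear equation. *)
Lemma linear_ode_norm_le (R : realType) (m n : nat) (A : R -> 'M[R]_m)
    (X : R -> 'M[R]_(m, n)) (a b alpha : R) :
  0 <= alpha -> {within `[a, b], continuous X} ->
  (forall s, a < s < b -> rderiv X s (A s *m X s) /\ `|A s| <= alpha) ->
  forall t, a <= t <= b -> `|X t| <= `|X a| * expR (m%:R * alpha * (t - a)).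
Proof.
move=> alpha0 cX H t tab.
have := @gronwall_rderiv R _ X (fun s => A s *m X s) a b (m%:R * alpha) 0
  (`|X a| * expR (m%:R * alpha * (b - a)) + 1) _ (lexx _) cX _ _ t tab.
rewrite !mul0r addr0; apply; first by rewrite mulr_ge0.
  by rewrite ltrDl.
move=> s /H[rX As] _; split=> //; rewrite addr0.
by apply: le_trans (mulmx_norm_le _ _) _; rewrite ler_wpM2r// ler_wpM2l.
Qed.

Definition fundamental_solution (R : realType) (m : nat) (A : R -> 'M[R]_m)
    (t0 t1 : R) (Phi : R -> R -> 'M[R]_m) : Prop :=
  forall s, t0 <= s <= t1 ->
    (forall t, t0 <= t <= t1 ->
       derivative_within `[t0, t1] (Phi ^~ s) t (A t *m Phi t s)) /\
    Phi s s = 1%:M.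

Section FundamentalSolution.
Variables (R : realType) (m : nat) (A : R -> 'M[R]_m) (t0 t1 alpha : R).
Variable Phi : R -> R -> 'M[R]_m.
Hypothesis alpha0 : 0 <= alpha.
Hypothesis A_le : forall s, t0 <= s <= t1 -> `|A s| <= alpha.
Hypothesis PhiP : fundamental_solution A t0 t1 Phi.

Let cPhi s x y : t0 <= s <= t1 -> t0 <= x -> y <= t1 ->
  {within `[x, y], continuous (Phi ^~ s)}.
Proof.
move=> /PhiP[H _] tx yt; apply: continuous_subspaceW (derivative_within_continuous H).
move=> z /=; rewrite !in_itv /= => /andP[xz zy].
by rewrite (le_trans tx xz) (le_trans zy yt).
Qed.

Let rPhi s x : t0 <= s <= t1 -> t0 <= x < t1 -> rderiv (Phi ^~ s) x (A x *m Phi x s).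
Proof.
move=> /PhiP[H _] /andP[tx xt]; apply: (@derivative_within_rderiv _ _ t0 t1); last by rewrite tx xt.
by apply: H; rewrite tx ltW.
Qed.

(** As functions of [t] both sides solve the equation on [[x, t]] and agree at
    [x]. *)
Lemma fundamental_solution_cocycle s x t : t0 <= s -> s <= x -> x <= t -> t <= t1 ->
  Phi t s = Phi t x *m Phi x s.
Proof.
move=> ts sx xt tt.
have x01 : t0 <= x <= t1 by rewrite (le_trans ts sx) (le_trans xt tt).
have s01 : t0 <= s <= t1 by rewrite ts (le_trans sx (le_trans xt tt)).
pose W y := Phi y s - Phi y x *m Phi x s.
have cW : {within `[x, t], continuous W}.
  apply: within_continuousB; first by apply: cPhi => //; case/andP: x01.
  have /subspace_continuousP H : {within `[x, t], continuous (Phi ^~ x)}.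
    by apply: cPhi => //; case/andP: x01.
  apply/subspace_continuousP => z zxt.
  apply: (@cvg_mulmx _ _ _ _ _ _ _ (Phi ^~ x) (fun=> Phi x s)); first exact: H.
  exact: cvg_cst.
have Wx : W x = 0 by rewrite /W (PhiP x01).2 mul1mx subrr.
have := @linear_ode_norm_le R m m A W x t alpha alpha0 cW _ t.
rewrite Wx normr0 mul0r normr_le0 xt lexx => /(_ _ isT) H.
apply/eqP; rewrite -subr_eq0; apply: H => z /andP[xz zt].
have z01 : t0 <= z < t1.
  by case/andP: x01 => tx _; rewrite (le_trans tx (ltW xz)) (lt_le_trans zt).
split; last by apply: A_le; case/andP: z01 => -> /ltW ->.
rewrite /W mulmxBr mulmxA; apply: rderivB; first exact: rPhi.
by apply: rderiv_mulmxr; exact: rPhi.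
Qed.

Let C0 := expR (m%:R * alpha * (t1 - t0)).

Lemma fundamental_solution_norm_le s t : t0 <= s -> s <= t -> t <= t1 ->
  `|Phi t s| <= C0.
Proof.
move=> ts st tt.
have s01 : t0 <= s <= t1 by rewrite ts (le_trans st tt).
have := @linear_ode_norm_le R m m A (Phi ^~ s) s t alpha alpha0 (cPhi s01 ts tt) _ t.
rewrite st lexx (PhiP s01).2 => /(_ _ isT) H.
apply: (le_trans (H _)).
  move=> z /andP[sz zt]; have z01 : t0 <= z < t1.
    by rewrite (le_trans ts (ltW sz)) (lt_le_trans zt).
  split; first exact: rPhi.
  by apply: A_le; case/andP: z01 => -> /ltW ->.
rewrite -[leRHS]mul1r; apply: ler_pM; rewrite ?normr_ge0 ?expR_ge0//.
  apply: mx_norm_le => // i j; rewrite mxE.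
  by case: eqP => _; rewrite ?normr1// normr0.
rewrite ler_expR; apply: ler_wpM2l; first exact: mulr_ge0.
exact: lerB.
Qed.

Lemma fundamental_solution_near_id s x : t0 <= s -> s <= x -> x <= t1 ->
  `|Phi x s - 1%:M| <= m%:R * alpha * C0 * (x - s).
Proof.
move=> ts sx xt.
have s01 : t0 <= s <= t1 by rewrite ts (le_trans sx xt).
have b0 : 0 <= m%:R * alpha * C0 by rewrite !mulr_ge0 ?expR_ge0.
rewrite -(PhiP s01).2.
apply: (mean_value_rderiv_norm_le sx b0 (cPhi s01 ts xt)
  (w' := fun y => A y *m Phi y s)) => z /andP[sz zx].
have z01 : t0 <= z < t1.
  by rewrite (le_trans ts (ltW sz)) (lt_le_trans zx).
split; first exact: rPhi.
apply: le_trans (mulmx_norm_le _ _) _.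
case/andP: z01 => z0 z1.
apply: ler_pM => //.
  by rewrite ler_wpM2l// A_le// z0 ltW.
by apply: fundamental_solution_norm_le => //; exact: ltW.
Qed.

(** By the cocycle identity [Phi t x - Phi t z] is
    [Phi t z *m (Phi z x - 1)], so [Phi t] is Lipschitz. *)
Lemma fundamental_solution_continuous_r a t : t0 <= a -> t <= t1 ->
  {within `[a, t], continuous (Phi t)}.
Proof.
move=> ta tt; apply/subspace_continuousP => s; rewrite /= in_itv /= => /andP[as_ st].
pose L := m%:R * C0 * (m%:R * alpha * C0).
have L0 : 0 <= L by rewrite !mulr_ge0 ?expR_ge0.
have lip x z : t0 <= x -> x <= z -> z <= t -> `|Phi t x - Phi t z| <= L * (z - x).
  move=> tx xz zt.
  rewrite (fundamental_solution_cocycle tx xz zt tt) -{2}[Phi t z]mulmx1 -mulmxBr.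
  apply: le_trans (mulmx_norm_le _ _) _; rewrite /L -[leRHS]mulrA.
  apply: ler_pM; [exact: mulr_ge0|exact: normr_ge0| |].
    rewrite ler_wpM2l// fundamental_solution_norm_le//; exact: le_trans xz.
  by rewrite fundamental_solution_near_id// (le_trans zt).
apply/cvgrPdist_le => /= e e0.
change (\forall x \near s, `[a, t]%classic x -> `|Phi t s - Phi t x| <= e).
near=> x => /=.
rewrite in_itv /= => /andP[ax xt].
have : `|s - x| <= e / (L + 1).
  near: x; apply: (@cvgr_dist_le _ _ _ (nbhs s) _ id s); first exact: cvg_id.
  by rewrite divr_gt0// ltr_wpDl.
rewrite ler_pdivlMr ?ltr_wpDl// => sx.
have sx' : L * `|s - x| <= e.
  by apply: le_trans sx; rewrite mulrC ler_wpM2l// lerDl.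
have [xs|sx''] := leP x s.
  rewrite distrC; apply: le_trans (lip _ _ (le_trans ta ax) xs st) _.
  by move: sx'; rewrite ger0_norm ?subr_ge0.
apply: le_trans (lip _ _ (le_trans ta as_) (ltW sx'') xt) _.
by move: sx'; rewrite distrC ger0_norm ?subr_ge0 ?(ltW sx'').
Unshelve. all: by end_near. Qed.

(** Variation of constants: by the cocycle identity the difference quotient is
    [Phi t x] times the difference quotient of [u x - Phi x s *m u s], where [s]
    is fixed. *)
Lemma rderiv_variation (u : R -> 'cV[R]_m) (du : 'cV[R]_m) s t :
  t0 <= s -> s < t -> t <= t1 -> rderiv u s du ->
  rderiv (fun x => Phi t x *m u x) s (Phi t s *m (du - A s *m u s)).
Proof.
move=> ts st tt ru.
have s01 : t0 <= s < t1 by rewrite ts (lt_le_trans st).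
have s01' : t0 <= s <= t1 by case/andP: s01 => -> /ltW ->.
have PhiR : Phi t x @[x --> s^'+] --> Phi t s.
  have /subspace_continuousP/(_ s) := @fundamental_solution_continuous_r s t ts tt.
  rewrite /= in_itv /= lexx (ltW st) => /(_ isT).
  apply: cvg_trans; apply: cvg_app => P; rewrite /within /= => HP.
  change (\forall x \near s, s < x -> P x).
  have tlb : \forall x \near s, x < t by exact: lt_nbhsl.
  near=> x => sx.
  have Px : `[s, t]%classic x -> P x by near: x.
  have xt : x < t by near: x.
  by apply: Px; rewrite /= in_itv /= (ltW sx) ltW.
have H := rPhi s01' s01.
rewrite /rderiv (PhiP s01').2 mulmx1 in H.
have H' : ((x - s)^-1 *: (Phi x s - 1%:M)) *m u s @[x --> s^'+] --> A s *m u s.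
  by apply: (@cvg_mulmx _ _ _ _ _ _ _ _ (fun=> u s)); [exact: H|exact: cvg_cst].
have H2 : Phi t x *m ((x - s)^-1 *: (u x - u s)
    - ((x - s)^-1 *: (Phi x s - 1%:M)) *m u s) @[x --> s^'+] -->
    Phi t s *m (du - A s *m u s).
  by apply: cvg_mulmx => //; apply: cvgB.
rewrite /rderiv; apply: cvg_trans H2; apply: near_eq_cvg; near=> x.
have sx : s < x by near: x; exact: nbhs_right_gt.
have xt : x <= t by near: x; exact: nbhs_right_le.
rewrite (fundamental_solution_cocycle ts (ltW sx) xt tt).
rewrite -mulmxA -mulmxBr -scalemxAl -scalerBr -scalemxAr mulmxBl mul1mx.
by rewrite opprB addrA subrK.
Unshelve. all: by end_near. Qed.

End FundamentalSolution.

(** * Integrals of vector-valued functions *)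

Section VectorIntegral.
Variables (R : realType) (m : nat) (a b : R) (g : R -> 'cV[R]_m).
Hypothesis cg : {within `[a, b], continuous g}.
Notation mu := (@lebesgue_measure R).

Let cgi i : {within `[a, b], continuous (fun x => g x i 0 : R)}.
Proof.
move/subspace_continuousP : cg => H; apply/subspace_continuousP => x xab.
exact: cvg_mx_entry (H x xab).
Qed.

Let intg i : mu.-integrable `[a, b] (EFin \o (fun x => g x i 0)).
Proof. by apply: continuous_compact_integrable; [exact: segment_compact|exact: cgi]. Qed.

(** The fundamental theorem of calculus, entry by entry. *)
Lemma rderiv_vector_integral s : a < s < b ->
  rderiv (fun x => vector_integral a x g) s (g s).
Proof.
move=> /andP[as_ sb].
have Hi i : rderiv (fun x => vector_integral a x g i 0) s (g s i 0 : R).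
  have [|dF DF] := @continuous_FTC1_closed R (fun x => g x i 0) a s b sb (intg i) as_.
    apply: (@within_continuous_continuous _ _ _ a b); [exact: lt_trans sb|exact: cgi|].
    by rewrite in_itv /= as_ sb.
  rewrite -DF derive1E.
  have := @rderiv_line R R R (fun x => \int[mu]_(t in `[a, x]) g t i 0) 0 1 s.
  rewrite [s *: 1]mulr1 add0r => /(_ dF).
  rewrite /rderiv; under eq_fun do rewrite add0r [_ *: 1]mulr1.
  rewrite add0r [s *: 1]mulr1.
  apply: cvg_trans; apply: near_eq_cvg; near=> x.
  by rewrite !mxE.
apply: cvg_mxP => i j; rewrite ord1; have := Hi i.
rewrite /rderiv; apply: cvg_trans; apply: near_eq_cvg; near=> x.
by rewrite !mxE.
Unshelve. all: by end_near. Qed.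

Lemma vector_integral_continuous : a <= b ->
  {within `[a, b], continuous (fun x => vector_integral a x g)}.
Proof.
move=> ab; apply/subspace_continuousP => x xab; apply: cvg_mxP => i j.
have /subspace_continuousP/(_ x xab) H := parameterized_integral_continuous ab (intg i).
rewrite mxE; under eq_fun do rewrite mxE; exact: H.
Qed.

Lemma vector_integral_point : vector_integral a a g = 0.
Proof. by apply/colP => i; rewrite !mxE set_itv1 Rintegral_set1. Qed.

(** One endpoint is negligible.  At [b = t0] the integrand of the theorem
    involves [y t0] where its continuous version has [phi t0]. *)
Lemma eq_vector_integral_co (h : R -> 'cV[R]_m) :
  {in `[a, b[, g =1 h} -> vector_integral a b g = vector_integral a b h.
Proof.
move=> gh; apply/colP => i; rewrite !mxE.
have intgo : mu.-integrable `[a, b[ (EFin \o (fun x => g x i 0)).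
  by apply: integrableS (intg i) => //; apply: subset_itvl; rewrite bnd_simp.
have ghi : {in `[a, b[%classic, (EFin \o (fun x => g x i 0)) =1 (EFin \o (fun x => h x i 0))}.
  by move=> x; rewrite inE /= => xab; rewrite gh.
rewrite -!Rintegral_itv_bndo_bndc//.
  by apply: eq_Rintegral => x; rewrite inE /= => xab; rewrite gh.
exact: (@eq_integrable _ _ _ mu _ (measurable_itv `[a, b[) _ _ ghi intgo).
Qed.

End VectorIntegral.

(** * Perturbation of the delay equation *)

(** The difference satisfies [`|u'| <= K * (`|u| + E)] as long as [`|u| <= 1];
    smallness of [E] keeps it there.  The length [b - a] is replaced by a bound
    [T] to make the constant uniform in the end of the interval. *)
Lemma solution_perturbation_le (R : realType) (m : nat)
    (f : 'cV[R]_m -> 'cV[R]_m -> 'cV[R]_m) (y yd p dp : R -> 'cV[R]_m)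
    (a b T K B E : R) :
  0 <= K ->
  (forall z w h k, `|z| <= B -> `|w| <= B -> `|h| <= 1 -> `|k| <= 1 ->
    `|f (z + h) (w + k) - f z w| <= K * (`|h| + `|k|)) ->
  b - a <= T ->
  {within `[a, b], continuous y} -> {within `[a, b], continuous yd} ->
  (forall s, a < s < b -> rderiv y s (f (y s) (p s))) ->
  (forall s, a < s < b -> rderiv yd s (f (yd s) (p s + dp s))) ->
  (forall s, a < s < b -> [/\ `|y s| <= B, `|p s| <= B & `|dp s| <= E]) ->
  `|yd a - y a| <= E -> E <= 1 ->
  E * ((1 + K * T) * expR (K * T)) < 1 ->
  forall s, a <= s <= b -> `|yd s - y s| <= E * ((1 + K * T) * expR (K * T)).
Proof.
move=> K0 fK baT cy cyd ry ryd bnd ua E1 EC s sab.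
have E0 : 0 <= E by exact: le_trans ua.
have bound x : a <= x <= b ->
    (`|yd a - y a| + K * E * (x - a)) * expR (K * (x - a)) <=
    E * ((1 + K * T) * expR (K * T)).
  move=> /andP[ax xb]; have xT : x - a <= T by apply: le_trans baT; rewrite lerD2r.
  have xa : 0 <= x - a by rewrite subr_ge0.
  rewrite mulrA; apply: ler_pM; rewrite ?expR_ge0//.
  - by apply: addr_ge0 => //; apply: mulr_ge0 => //; exact: mulr_ge0.
  - rewrite [leRHS]mulrDr mulr1; apply: lerD => //; rewrite mulrA [E * K]mulrC.
    by rewrite ler_wpM2l// mulr_ge0.
  - by rewrite ler_expR ler_wpM2l.
have ab : a <= b by case/andP: sab => /le_trans; apply.
have cw : {within `[a, b], continuous (yd \- y)} by exact: within_continuousB.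
have := @gronwall_rderiv R _ (yd \- y) (fun x => f (yd x) (p x + dp x) - f (y x) (p x))
  a b K (K * E) 1 K0 (mulr_ge0 K0 E0) cw _ _ s sab.
move=> H; apply: le_trans (bound s sab); apply: H.
  by apply: le_lt_trans EC; apply: bound; rewrite ab lexx.
move=> x xab wx; split; first by apply: rderivB; [exact: ryd|exact: ry].
have [yB pB dE] := bnd x xab.
have -> : yd x = y x + (yd x - y x) by rewrite addrC subrK.
apply: (le_trans (fK _ _ _ _ yB pB wx (le_trans dE E1))).
by rewrite -mulrDr ler_wpM2l// lerD2l.
Qed.

(** [C1] is the growth factor of a perturbation, [C0] bounds the fundamental
    solution, and [K * (E * C1 + E) ^+ 2] bounds the remainder of the
    linearisation. *)
Lemma perturbation_remainder_le (R : realType) (m : nat)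
    (f : 'cV[R]_m -> 'cV[R]_m -> 'cV[R]_m) (t0 tau xi K B : R)
    (eta : 'cV[R]_m) (phi y : R -> 'cV[R]_m) (Phi : R -> R -> 'M[R]_m) :
  let C1 := (1 + K * tau) * expR (K * tau) in
  let C0 := expR (m%:R * K * tau) in
  class_C 2 (fun p : 'cV[R]_m * 'cV[R]_m => f p.1 p.2) ->
  0 <= K ->
  (forall z w h k, `|z| <= B -> `|w| <= B -> `|h| <= 1 -> `|k| <= 1 ->
    [/\ `|F1 f z w| <= K, `|F2 f z w| <= K,
        `|f (z + h) (w + k) - f z w| <= K * (`|h| + `|k|)
      & `|f (z + h) (w + k) - f z w - (F1 f z w *m h + F2 f z w *m k)|
          <= K * (`|h| + `|k|) ^+ 2]) ->
  0 < tau ->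
  t0 <= xi <= t0 + tau ->
  {within `[t0 - tau, t0], continuous phi} ->
  (forall s, t0 <= s <= t0 + tau -> `|y s| <= B) ->
  (forall s, t0 - tau <= s <= t0 -> `|phi s| <= B) ->
  dde_solution f t0 tau xi eta phi y ->
  variational_solution f t0 tau phi y Phi ->
  forall (deta : 'cV[R]_m) (dphi yd : R -> 'cV[R]_m) (t E : R),
    {within `[t0 - tau, t0], continuous dphi} ->
    dde_solution f t0 tau xi (eta + deta) (phi \+ dphi) yd ->
    xi <= t <= t0 + tau ->
    `|deta| <= E ->
    (forall s, xi - tau <= s <= t - tau -> `|dphi s| <= E) ->
    E * C1 < 1 ->
    `|yd t - (y t + Phi t xi *m deta
              + vector_integral (xi - tau) (t - tau)
                  (fun zeta => Psi f tau y Phi t zeta *m dphi zeta))|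
      <= m%:R * C0 * (K * (E * C1 + E) ^+ 2) * (t - xi).
Proof.
move=> C1 C0 fC2 K0 fK tau0 /andP[t0xi xit1] cphi yB phiB [dy yxi yphi] PhiV
  deta dphi yd t E cdphi [dyd ydxi _] /andP[xit tt1] detaE dphiE EC.
pose A s := F1 f (y s) (phi (s - tau)).
have t01 : t0 <= t0 + tau by rewrite lerDl ltW.
have cy := derivative_within_continuous dy.
have cyd := derivative_within_continuous dyd.
have shift_itv s : t0 <= s <= t0 + tau -> t0 - tau <= s - tau <= t0.
  by move=> /andP[s0 s1]; rewrite lerD2r s0 lerBlDr.
have norm0 : `|(0 : 'cV[R]_m)| <= 1 by rewrite normr0.
have A_le s : t0 <= s <= t0 + tau -> `|A s| <= K.
  move=> s01.
  have [H _ _ _] := fK _ _ 0 0 (yB _ s01) (phiB _ (shift_itv _ s01)) norm0 norm0.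
  exact: H.
have PhiP : fundamental_solution A t0 (t0 + tau) Phi by exact: PhiV.
have E0 : 0 <= E by exact: le_trans detaE.
have C11 : 1 <= C1.
  rewrite /C1 mulr_ege1//; first by rewrite lerDl mulr_ge0// ltW.
  by rewrite -expR0 ler_expR mulr_ge0// ltW.
have E1 : E <= 1.
  by apply: le_trans (ltW EC); rewrite -[leLHS]mulr1 ler_wpM2l.
have sub_itv s : xi <= s <= t -> t0 <= s <= t0 + tau.
  by move=> /andP[xs st]; rewrite (le_trans t0xi xs) (le_trans st tt1).
have sub_oo s : xi < s < t -> t0 <= s < t0 + tau.
  by move=> /andP[xs st]; rewrite (le_trans t0xi (ltW xs)) (lt_le_trans st tt1).
have oo_cc s : xi < s < t -> xi <= s <= t by move=> /andP[/ltW -> /ltW ->].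
have restr (w : R -> 'cV[R]_m) : {within `[t0, t0 + tau], continuous w} ->
    {within `[xi, t], continuous w}.
  by apply: continuous_subspaceW => s /=; rewrite !in_itv /=; exact: sub_itv.
have ry s : xi < s < t -> rderiv y s (f (y s) (phi (s - tau))).
  move=> sxt; apply: derivative_within_rderiv (sub_oo s sxt).
  by apply: dy; exact: sub_itv (oo_cc s sxt).
have ryd s : xi < s < t -> rderiv yd s (f (yd s) (phi (s - tau) + dphi (s - tau))).
  move=> sxt; apply: derivative_within_rderiv (sub_oo s sxt).
  by apply: dyd; exact: sub_itv (oo_cc s sxt).
have dpE s : xi <= s <= t -> `|dphi (s - tau)| <= E.
  by move=> /andP[xs st]; apply: dphiE; rewrite !lerD2r xs st.
pose u := yd \- y.
have uxi : u xi = deta by rewrite /u /= ydxi yxi addrC addKr.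
have u_le s : xi <= s <= t -> `|u s| <= E * C1.
  have fK3 z w h k : `|z| <= B -> `|w| <= B -> `|h| <= 1 -> `|k| <= 1 ->
      `|f (z + h) (w + k) - f z w| <= K * (`|h| + `|k|).
    by move=> a1 a2 a3 a4; have [_ _ H _] := fK z w h k a1 a2 a3 a4; exact: H.
  apply: (@solution_perturbation_le R m f y yd (fun s => phi (s - tau))
    (fun s => dphi (s - tau)) xi t tau K B E K0 fK3 _ (restr _ cy) (restr _ cyd) ry ryd).
  - by rewrite lerBlDr (le_trans tt1)// addrC lerD2l.
  - move=> x xxt; have x01 := sub_itv _ (oo_cc _ xxt); split.
    + exact: yB.
    + exact: phiB (shift_itv _ x01).
    + exact: dpE (oo_cc _ xxt).
  - by have := uxi; rewrite /u /= => ->.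
  - exact: E1.
  - exact: EC.
(* [G] is the integrand of the theorem with [phi zeta] in place of [y zeta];
   unlike the latter it is continuous up to [t0]. *)
pose G zeta := Phi t (zeta + tau) *m (F2 f (y (zeta + tau)) (phi zeta) *m dphi zeta).
have cPhi : {within `[xi, t], continuous (Phi t)}.
  exact: (fundamental_solution_continuous_r K0 A_le PhiP).
have shiftP (T : topologicalType) (w : R -> T) : {within `[xi, t], continuous w} ->
    {within `[xi - tau, t - tau], continuous (fun x => w (x + tau))}.
  move=> cw; rewrite -[X in fun x => w (x + X)]opprK.
  by apply: within_continuous_shift; rewrite opprK !subrK.
have restr0 (w : R -> 'cV[R]_m) : {within `[t0 - tau, t0], continuous w} ->
    {within `[xi - tau, t - tau], continuous w}.
  apply: continuous_subspaceW => s /=; rewrite !in_itv /= => /andP[xs st].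
  by rewrite (le_trans _ xs) ?lerD2r// (le_trans st)// lerBlDr.
have cG : {within `[xi - tau, t - tau], continuous G}.
  apply/subspace_continuousP => x xI; apply: cvg_mulmx.
    by move/subspace_continuousP: (shiftP _ _ cPhi); apply.
  apply: cvg_mulmx; last by move/subspace_continuousP: (restr0 _ cdphi); apply.
  apply: cvg_F2 => //.
    by move/subspace_continuousP: (shiftP _ _ (restr _ cy)); apply.
  by move/subspace_continuousP: (restr0 _ cphi); apply.
pose I x := vector_integral (xi - tau) (x - tau) G.
have EI : vector_integral (xi - tau) (t - tau)
    (fun zeta => Psi f tau y Phi t zeta *m dphi zeta) = I t.
  apply/esym/eq_vector_integral_co => // x; rewrite in_itv /= => /andP[xx xt].
  have yx : y x = phi x.
    apply: yphi; apply/andP; split; first by apply: le_trans xx; rewrite lerD2r.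
    by apply: lt_le_trans xt _; rewrite lerBlDr.
  by rewrite /G /Psi yx mulmxA.
have cI : {within `[xi, t], continuous I}.
  apply: (@within_continuous_shift R _ xi t tau (fun x => vector_integral (xi - tau) x G)).
  by apply: vector_integral_continuous => //; rewrite lerD2r.
pose q x := Phi t x *m u x - I x.
have cu : {within `[xi, t], continuous u}.
  by apply: within_continuousB; [exact: restr cyd|exact: restr cy].
have cPu : {within `[xi, t], continuous (fun x => Phi t x *m u x)}.
  apply/subspace_continuousP => x xI; apply: cvg_mulmx.
    by move/subspace_continuousP: cPhi; apply.
  by move/subspace_continuousP: cu; apply.
have cq : {within `[xi, t], continuous q} by exact: (within_continuousB cPu cI).
pose du s := f (yd s) (phi (s - tau) + dphi (s - tau)) - f (y s) (phi (s - tau)).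
pose D s := Phi t s *m (du s - A s *m u s) - G (s - tau).
have rq s : xi < s < t -> rderiv q s (D s).
  move=> sxt; have /andP[s0 s1] := sub_oo _ sxt.
  have /andP[xs st] := sxt.
  apply: rderivB.
    apply: (rderiv_variation K0 A_le PhiP s0 st tt1).
    by apply: rderivB; [exact: ryd|exact: ry].
  apply: (@rderiv_shift _ _ (fun x => vector_integral (xi - tau) x G)).
  apply: (rderiv_vector_integral cG).
  by rewrite !ltrD2r xs st.
(* The linear terms cancel in [D s]: what remains is the second-order
   remainder of [f], multiplied by the fundamental solution. *)
pose beta := m%:R * C0 * (K * (E * C1 + E) ^+ 2).
have beta0 : 0 <= beta.
  apply: mulr_ge0; first by apply: mulr_ge0; [exact: ler0n|exact: expR_ge0].
  by apply: mulr_ge0 => //; exact: sqr_ge0.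
have D_le s : xi < s < t -> `|D s| <= beta.
  move=> sxt; have /andP[xs st] := sxt.
  have sc := oo_cc _ sxt; have s01 := sub_itv _ sc.
  have -> : D s = Phi t s *m (f (y s + u s) (phi (s - tau) + dphi (s - tau))
      - f (y s) (phi (s - tau)) - (F1 f (y s) (phi (s - tau)) *m u s
        + F2 f (y s) (phi (s - tau)) *m dphi (s - tau))).
    have yu : y s + u s = yd s by rewrite /u /= addrC subrK.
    by rewrite /D /G subrK -mulmxBr yu opprD addrA.
  apply: le_trans (mulmx_norm_le _ _) _; apply: ler_pM => //.
    rewrite ler_wpM2l//.
    have := fundamental_solution_norm_le K0 A_le PhiP (proj1 (andP s01)) (ltW st) tt1.
    by rewrite [t0 + tau]addrC addrK.
  have us1 : `|u s| <= 1 by apply: le_trans (u_le _ sc) (ltW EC).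
  have dp1 : `|dphi (s - tau)| <= 1 by apply: le_trans (dpE _ sc) E1.
  have [_ _ _ H] := fK _ _ _ _ (yB _ s01) (phiB _ (shift_itv _ s01)) us1 dp1.
  apply: (le_trans H); rewrite ler_wpM2l// lerXn2r ?nnegrE ?addr_ge0//.
    by rewrite mulr_ge0// (le_trans ler01).
  by apply: lerD; [exact: u_le|exact: dpE].
rewrite EI.
have -> : yd t - (y t + Phi t xi *m deta + I t) = q t - q xi.
  have Ptt : Phi t t = 1%:M by apply: (PhiP t _).2; rewrite (le_trans t0xi xit).
  have Ixi : I xi = 0 by exact: vector_integral_point.
  rewrite /q Ptt mul1mx uxi Ixi subr0 /u /=.
  by rewrite !opprD !addrA addrAC.
apply: (mean_value_rderiv_norm_le xit beta0 cq (w' := D)) => s sxt.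
by split; [exact: rq|exact: D_le].
Qed.

(** Continuity makes the set bounded, so that its supremum is meaningful. *)
Lemma le_max_norm (R : realType) (m : nat) (N : 'cV[R]_m -> R) (a b : R)
    (g : R -> 'cV[R]_m) x :
  vector_norm N -> {within `[a, b], continuous g} -> a <= x <= b ->
  N (g x) <= max_norm N a b g.
Proof.
move=> Nn cg xab; have [c c0 Nc] := vector_norm_le Nn.
have [B gB] := within_continuous_bounded cg.
apply: ub_le_sup; last by exists x => //; rewrite /= in_itv.
exists (c * B) => _ [z zab <-]; apply: le_trans (Nc _) _.
by rewrite ler_pM2l// gB//; move: zab; rewrite /= in_itv.
Qed.

Theorem corollary5 (R : realType) (m : nat) (N : 'cV[R]_m -> R)
    (f : 'cV[R]_m -> 'cV[R]_m -> 'cV[R]_m)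
    (t0 tau xi : R) (eta : 'cV[R]_m) (phi y : R -> 'cV[R]_m)
    (Phi : R -> R -> 'M[R]_m) :
  vector_norm N ->
  class_C 2 (fun p : 'cV[R]_m * 'cV[R]_m => f p.1 p.2) ->
  0 < tau ->
  t0 <= xi <= t0 + tau ->
  {within `[t0 - tau, t0], continuous phi} ->
  dde_solution f t0 tau xi eta phi y ->
  variational_solution f t0 tau phi y Phi ->
  exists C r : R, 0 < r /\
    forall (deta : 'cV[R]_m) (dphi yd : R -> 'cV[R]_m) (t : R),
      {within `[t0 - tau, t0], continuous dphi} ->
      dde_solution f t0 tau xi (eta + deta) (phi \+ dphi) yd ->
      xi <= t <= t0 + tau ->
      let e := N deta + max_norm N (xi - tau) (t - tau) dphi in
      e < r ->
      N (yd t - (y t + Phi t xi *m deta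
                 + vector_integral (xi - tau) (t - tau)
                     (fun zeta => Psi f tau y Phi t zeta *m dphi zeta)))
        <= C * (t - xi) * e ^+ 2.
Proof.
move=> Nn fC2 tau0 xi01 cphi ySol PhiV.
have [c c0 Nc] := vector_norm_le Nn.
have [d d0 Nd] := vector_norm_ge Nn.
have [dy _ _] := ySol.
have [By yB] := within_continuous_bounded (derivative_within_continuous dy).
have [Bp phiB] := within_continuous_bounded cphi.
have [K K0 fK] := class_C2_local_bounds (Num.max By Bp) fC2.
have yB' s : t0 <= s <= t0 + tau -> `|y s| <= Num.max By Bp.
  by move=> /yB H; rewrite le_max H.
have phiB' s : t0 - tau <= s <= t0 -> `|phi s| <= Num.max By Bp.
  by move=> /phiB H; rewrite le_max H orbT.
pose C1 := (1 + K * tau) * expR (K * tau).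
pose C0 := expR (m%:R * K * tau).
have C10 : 0 < C1.
  by rewrite mulr_gt0 ?expR_gt0// ltr_wpDr// mulr_ge0// ltW.
(* The maximum norm of a perturbation of size [e] is at most [d * e], and [r] is
   such that it is multiplied by [C1] to at most 1. *)
exists (c * (m%:R * C0 * (K * (d * (C1 + 1)) ^+ 2))), (d * C1)^-1.
split=> [|deta dphi yd t cdphi ydSol xit e er]; first by rewrite invr_gt0 mulr_gt0.
have /andP[t0xi xit1] := xi01; have /andP[xit' tt1] := xit.
have cdphi' : {within `[xi - tau, t - tau], continuous dphi}.
  apply: continuous_subspaceW cdphi => s /=; rewrite !in_itv /= => /andP[xs st].
  by rewrite (le_trans _ xs) ?lerD2r// (le_trans st)// lerBlDr.
have dphiN s : xi - tau <= s <= t - tau -> N (dphi s) <= max_norm N (xi - tau) (t - tau) dphi.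
  exact: le_max_norm.
have mn0 : 0 <= max_norm N (xi - tau) (t - tau) dphi.
  apply: le_trans (dphiN (xi - tau) _); first exact: vector_norm_ge0.
  by rewrite lexx lerD2r.
have detaE : `|deta| <= d * e.
  by apply: le_trans (Nd _) _; rewrite ler_pM2l// lerDl.
have dphiE s : xi - tau <= s <= t - tau -> `|dphi s| <= d * e.
  move=> sI; apply: le_trans (Nd _) _; rewrite ler_pM2l//.
  by apply: le_trans (dphiN _ sI) _; rewrite lerDr vector_norm_ge0.
have EC : d * e * C1 < 1.
  have -> : d * e * C1 = e * (d * C1) by ring.
  have dC0 : 0 < d * C1 by exact: mulr_gt0.
  by rewrite -(mulVf (lt0r_neq0 dC0)) ltr_pM2r.
have H := perturbation_remainder_le fC2 K0 fK tau0 xi01 cphi yB' phiB' ySol PhiV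
  cdphi ydSol xit detaE dphiE EC.
apply: le_trans (Nc _) _.
rewrite (_ : _ * _ * e ^+ 2 =
    c * (m%:R * C0 * (K * (d * e * C1 + d * e) ^+ 2) * (t - xi))); last by ring.
by rewrite ler_pM2l.
Qed.
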